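(* Let $d \ge 2$. Suppose $E \subset \mathbb{R}^d$ is Salem and $s := \dim_{\mathcal H}(E) > d-1$. Then $\mathcal{L}^1(\mathcal{V}(E)) > 0$.
   Context: $\dim_{\mathcal H}$ denotes Hausdorff dimension and $\mathcal{L}^1$ denotes one-dimensional Lebesgue measure on $\mathbb{R}$. For $E \subset [0,1]^d$, the volume set of $E$ is $\mathcal{V}(E) = \{\det(x^1,\dots,x^d) \in \mathbb{R} : x^j \in E,\ 1\le j\le d\}$, where $\det(x^1,\dots,x^d)$ is the determinant of the $d\times d$ matrix whose $j$th column is $x^j$. A set $E \subset [0,1]^d$, $d\ge 2$, with Hausdorff dimension $s$ is called Salem if there exists a probability measure $\mu$ supported on $E$ such that $|\widehat{\mu}(\xi)| \lessapprox |\xi|^{-s/2}$ as $|\xi| \to \infty$, i.e. for every $\epsilon > 0$ there exists $C_\epsilon > 0$ such that $|\widehat{\mu}(\xi)| \le C_\epsilon |\xi|^{\epsilon} |\xi|^{-s/2}$ for all sufficiently large $|\xi|$. Here $\widehat{\mu}(\xi) = \int e^{-2\pi i x\cdot \xi}\, d\mu(x)$. *)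

(* Defs.v *)
From HB Require Import structures.
From mathcomp Require Import all_boot all_order all_algebra.
From mathcomp Require Import all_classical all_reals all_analysis.
From mathcomp Require Import complex.

Set Implicit Arguments.
Unset Strict Implicit.
Unset Printing Implicit Defensive.

Import Order.TTheory GRing.Theory Num.Theory.

Local Open Scope classical_set_scope.
Local Open Scope ring_scope.

(* R^d is represented by d.-tuple R, whose sigma-algebra is the product of the
   Borel sigma-algebras of the factors, that is, the Borel one. *)

Section Euclidean.
Context {R : realType} {d : nat}.
Implicit Types (x y : d.-tuple R).

Definition dotp x y : R := \sum_(i < d) tnth x i * tnth y i.

Definition enorm x : R := Num.sqrt (dotp x x).

Definition edist x y : R :=
  Num.sqrt (\sum_(i < d) (tnth x i - tnth y i) ^+ 2).

End Euclidean.

Section Hausdorff.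
Context {R : realType} {d : nat}.
Implicit Types (A : set (d.-tuple R)) (s delta : R).
Local Open Scope ereal_scope.

Definition diam A : \bar R :=
  ereal_sup [set (edist p.1 p.2)%:E | p in A `*` A].

(* The empty set has cost 0 for every s, including s = 0; a singleton has
   cost 0 `^ s, which is 1 if s = 0 and 0 if s > 0. *)
Definition diam_pow s A : \bar R :=
  if A == set0 then 0 else diam A `^ s.

Definition hausdorff_content s delta A : \bar R :=
  ereal_inf [set \sum_(0 <= k <oo) diam_pow s (U k) | U in
    [set U : (set (d.-tuple R))^nat |
      A `<=` \bigcup_k U k /\ forall k, diam (U k) <= delta%:E]].

Definition hausdorff_measure s A : \bar R :=
  ereal_sup [set hausdorff_content s delta A | delta in
    [set delta : R | (0 < delta)%R]].

Definition hausdorff_dim A : \bar R :=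
  ereal_inf [set s%:E | s in
    [set s : R | (0 <= s)%R /\ hausdorff_measure s A = 0]].

End Hausdorff.

Section Fourier.
Context {R : realType}.

(* exp (i t) for real t *)
Definition expi (t : R) : R[i] := (cos t +i* sin t)%C.

Definition Cintegral {disp : measure_display} {T : measurableType disp}
    (mu : {measure set T -> \bar R}) (f : T -> R[i]) : R[i] :=
  ((\int[mu]_x complex.Re (f x))%R +i* (\int[mu]_x complex.Im (f x))%R)%C.

Definition fourier {d : nat} (mu : {measure set (d.-tuple R) -> \bar R})
    (xi : d.-tuple R) : R[i] :=
  Cintegral mu (fun x => expi (- (2 * pi * dotp x xi))).

End Fourier.

Section Salem.
Context {R : realType} {d : nat}.
Implicit Types (E : set (d.-tuple R)).

Definition fourier_decay (mu : {measure set (d.-tuple R) -> \bar R}) (s : R) : Prop :=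
  forall eps : R, 0 < eps ->
    exists2 C : R, 0 < C & exists M : R, forall xi : d.-tuple R,
      M <= enorm xi ->
      Normc.normc (fourier mu xi) <= C * enorm xi `^ eps * enorm xi `^ (- (s / 2)).

(* "mu is supported on E" means that mu gives no mass to the complement of E;
   E itself is not required to be measurable. *)
Definition salem E : Prop :=
  exists2 s : R, hausdorff_dim E = s%:E &
    exists2 mu : probability (d.-tuple R) R,
      mu.-negligible (~` E) & fourier_decay mu s.

Definition volume_set E : set R :=
  [set v | exists2 x : 'I_d -> d.-tuple R,
    forall j, E (x j) & v = \det (\matrix_(i < d, j < d) tnth (x j) i)].

End Salem.

(* Main.v *)
Require Import Defs.
From mathcomp Require Import all_boot all_order all_algebra.
From mathcomp Require Import all_classical all_reals all_analysis.
From mathcomp Require Import complex.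
From mathcomp Require Import measurable_realfun.
From mathcomp Require Import ring lra.

Set Implicit Arguments.
Unset Strict Implicit.
Unset Printing Implicit Defensive.

Import Order.TTheory GRing.Theory Num.Theory.
Import numFieldNormedType.Exports.

Local Open Scope classical_set_scope.
Local Open Scope ring_scope.

(** The measure mu carried by E satisfies |mu^(xi)| <= C |xi|^(- b) for some
    b > 1/2, since s > d - 1 >= 1.  The volume set of E contains the image of E
    under the linear form x |-> x . N whenever N is the cofactor vector of
    d - 1 points of E, and one nonzero such N is enough: the statement reduces
    to the positivity of the outer measure of each projection
    {x . N : x in E} with N nonzero (projection_gt0).

    Fix N and let X be the random variable x |-> x . N under mu.  The squared
    modulus q(k) of the characteristic function of X at an integer k is
    |mu^(k N / 2 pi)|^2 = O(k^(- 2 b)), so that q is summable.  The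
    classical conclusion would be that the law of X is absolutely continuous with
    a square integrable density; what is proved is a quantitative form of the
    needed half, which uses neither Plancherel's theorem nor product measures.  The unnormalized Fejer kernel
    |sum_(j < n) exp(i j u)|^2 is nonnegative, at least (n cos 1)^2 for
    n |u| <= 1, and its average over two independent copies of X is
    sum_(j, l < n) q(j - l) = O(n).  So, outside of an event of
    probability O(1 / eta) (Markov's inequality), every event on which X
    varies by at most 1 / n has probability at most eta / n; covering
    intervals of total length L by intervals of length 1 / n gives them
    probability at most O(1 / eta) + eta L.  A Lebesgue null set has covers with
    L arbitrarily small, so it cannot carry the law of X
    (lebesgue_measure_gt0_of_sqr_char).

    The existence of N is a second application of the same fact: if the points
    of E spanned a proper subspace, some nonzero N would be orthogonal to all of
    them, and the projection {x . N : x in E} would lie in {0}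
    (exists_row_free). *)

(** * The Fejer kernel *)

Section Kernel.
Context {R : realType}.
Implicit Types (n : nat) (u t : R).

(** The squared modulus of the sum of exp (i j u) over j < n, that is, n times
    the usual Fejer kernel. *)
Definition fejer n u : R :=
  (\sum_(j < n) cos (j%:R * u)) ^+ 2 + (\sum_(j < n) sin (j%:R * u)) ^+ 2.

Lemma fejer_ge0 n u : 0 <= fejer n u.
Proof. by rewrite addr_ge0// sqr_ge0. Qed.

Lemma fejerE n u :
  fejer n u = \sum_(j < n) \sum_(l < n) cos ((j%:R - l%:R) * u).
Proof.
rewrite /fejer !expr2 !big_distrlr/= -big_split; apply: eq_bigr => j _ /=.
by rewrite -big_split; apply: eq_bigr => l _ /=; rewrite mulrBl cosB.
Qed.

Lemma cos1_le_cos u : `|u| <= 1 -> cos 1 <= cos u.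
Proof.
move=> u1; rewrite -(cos_norm u) leNgt.
have pi1 : 1 <= pi :> R by have := pihalf_ge1 R; lra.
by rewrite ltr_cos ?in_itv/= ?ler01 ?normr_ge0 ?(le_trans u1)// -leNgt.
Qed.

(** All the phases j u, with j < n, are within 1 of the origin, so that the
    cosines add up without cancellation. *)
Lemma fejer_near0 n u : n%:R * `|u| <= 1 -> (n%:R * cos 1) ^+ 2 <= fejer n u.
Proof.
move=> nu; rewrite -[leLHS]addr0 lerD ?sqr_ge0//.
have n0 : 0 <= n%:R * cos 1 :> R by rewrite mulr_ge0// ltW// cos1_gt0.
have le_sum : n%:R * cos 1 <= \sum_(j < n) cos (j%:R * u).
  rewrite -[n in n%:R]card_ord mulr_natl -sumr_const ler_sum// => j _.
  rewrite cos1_le_cos// normrM (le_trans _ nu)// ler_wpM2r// ger0_norm//.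
  by rewrite ler_nat ltnW.
by rewrite lerXn2r// nnegrE// (le_trans n0).
Qed.

End Kernel.

Section Energy.
Context {R : realType}.

(** Passing from n to n + 1 adds one row and one column, whose sums, up to the
    common corner q 0, are partial sums of q over the nonnegative integers. *)
Lemma toeplitz_sum_le (q : R -> R) (K : R) n :
  (forall t, q (- t) = q t) -> (forall t, 0 <= q t) ->
  (forall m, \sum_(k < m) q k%:R <= K) ->
  \sum_(j < n) \sum_(l < n) q (j%:R - l%:R) <= 2 * K * n%:R.
Proof.
move=> qN q0 qK.
elim: n => [|n IH]; first by rewrite big_ord0 mulr0.
rewrite big_ord_recr/=; under eq_bigr do rewrite big_ord_recr/=.
rewrite big_split/= big_ord_recr/= subrr.
have -> : \sum_(i < n) q (i%:R - n%:R) = \sum_(l < n) q (n%:R - l%:R).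
  by apply: eq_bigr => i _; rewrite -qN opprB.
have h : \sum_(l < n) q (n%:R - l%:R) + q 0 <= K.
  rewrite (reindex_inj rev_ord_inj)/=.
  rewrite (le_trans _ (qK n.+1))// big_ord_recl/= addrC lerD//.
  apply: ler_sum => l _; rewrite natrB ?ltn_ord// opprB addrC subrK.
  by rewrite /bump/= add1n.
have -> : 2 * K * n.+1%:R = 2 * K * n%:R + 2 * K by ring.
move: IH h; set a := \sum_(_ < _) _.
set b := \sum_(_ < _) _; set c := q 0; have := q0 0; rewrite -/c.
lra.
Qed.

End Energy.

(** * Partial sums of negative powers *)

Section PowerSeries.
Context {R : realType}.

(** The discrete counterpart of the antiderivative of the power function; it
    follows from expR y >= 1 + y at y = - a ln (x / (x + 1)) >= a / (x + 1). *)
Lemma powRN_telescope (a x : R) : 0 < a -> 0 < x ->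
  a * (x + 1) `^ (- (1 + a)) <= x `^ (- a) - (x + 1) `^ (- a).
Proof.
move=> a0 x0; have y0 : 0 < x + 1 by lra.
pose r := x / (x + 1).
have r0 : 0 < r by rewrite divr_gt0.
have -> : x `^ (- a) = (x + 1) `^ (- a) * r `^ (- a).
  by rewrite -powRM ?ltW// /r mulrCA divff ?mulr1// gt_eqF.
have -> : (x + 1) `^ (- (1 + a)) = (x + 1) `^ (- a) * (x + 1)^-1.
  rewrite -[in X in _ = _ * X](powR_inv1 (ltW y0)).
  rewrite -powRD ?(gt_eqF y0) ?implybT//.
  by congr (_ `^ _); ring.
rewrite -[X in _ <= _ - X]mulr1 -mulrBr mulrCA ler_wpM2l ?powR_ge0//.
rewrite /powR gt_eqF// lerBrDr (le_trans _ (expR_ge1Dx _))// addrC lerD2l.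
rewrite mulNr -mulrN ler_wpM2l ?(ltW a0)// lerNr.
have -> : r = 1 + - (x + 1)^-1 by rewrite /r; field; rewrite gt_eqF.
rewrite le_ln1Dx// ltrN2 invf_lt1//; lra.
Qed.

Lemma sum_powRN_le (a : R) m : 0 < a ->
  \sum_(k < m) k.+1%:R `^ (- (1 + a)) <= 1 + a^-1.
Proof.
move=> a0.
suff h n : \sum_(k < n.+1) k.+1%:R `^ (- (1 + a)) <=
    1 + a^-1 * (1 - n.+1%:R `^ (- a)).
  case: m => [|m]; first by rewrite big_ord0 addr_ge0// invr_ge0 ltW.
  rewrite (le_trans (h m))// lerD2l -[leRHS]mulr1.
  by rewrite ler_wpM2l ?invr_ge0 ?(ltW a0)// gerBl powR_ge0.
elim: n => [|n IH]; first by rewrite big_ord1 !powR1 subrr mulr0 addr0.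
rewrite big_ord_recr/=.
have := @powRN_telescope a n.+1%:R a0 (ltr0Sn _ _).
rewrite natr1 mulrC -ler_pdivlMr// mulrC => h.
by rewrite (le_trans (lerD IH h))// -addrA -mulrDr addrA subrK.
Qed.

Lemma sum_le_of_powR_decay (q : nat -> R) (D a : R) (k0 : nat) :
  0 < a -> 0 <= D -> (forall k, 0 <= q k) ->
  (forall k, (k0 <= k)%N -> q k.+1 <= D * k.+1%:R `^ (- (1 + a))) ->
  forall m, \sum_(k < m) q k <= \sum_(k < k0.+1) q k + D * (1 + a^-1).
Proof.
move=> a0 D0 q0 qD m.
have q_ndecr i j : (i <= j)%N -> \sum_(k < i) q k <= \sum_(k < j) q k.
  by move=> ij; rewrite -!(big_mkord xpredT q); apply: nondecreasing_series.
suff h n : \sum_(k < n.+1) q k <=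
    \sum_(k < k0.+1) q k + D * \sum_(k < n) k.+1%:R `^ (- (1 + a)).
  rewrite (le_trans (q_ndecr m m.+1 (leqnSn m)))// (le_trans (h m))// lerD2l.
  by rewrite ler_wpM2l// sum_powRN_le.
elim: n => [|n IH]; first by rewrite big_ord0 mulr0 addr0 q_ndecr.
have [k0n|nk0] := leqP k0 n.
  rewrite big_ord_recr/= [X in _ + D * X]big_ord_recr/= mulrDr addrA.
  by rewrite lerD// qD.
rewrite (le_trans (q_ndecr n.+2 k0.+1 _))// lerDl mulr_ge0//.
by apply: sumr_ge0 => k _; exact: powR_ge0.
Qed.

End PowerSeries.

(** * Averaging the Fejer kernel against a law *)

Section FiniteSumIntegral.
Context d (T : measurableType d) (R : realType) (P : probability T R).

Lemma integrable_bounded_rv (f : T -> R) (M : R) : measurable_fun setT f ->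
  (forall x, `|f x| <= M) -> P.-integrable setT (EFin \o f).
Proof.
move=> mf fM; apply: measurable_bounded_integrable => //.
  by rewrite (le_lt_trans (probability_le1 P _)) ?ltry.
exists M; split; first by rewrite num_real.
by move=> N MN x _ /=; rewrite (le_trans (fM x))// ltW.
Qed.

Lemma integrable_Rsum I (r : seq I) (F : I -> T -> R) :
  (forall i, P.-integrable setT (EFin \o F i)) ->
  P.-integrable setT (EFin \o (fun x => \sum_(i <- r) F i x)).
Proof.
move=> iF; rewrite (_ : _ \o _ = fun x => (\sum_(i <- r) (F i x)%:E)%E).
  by apply: integrable_sum => // i _; exact: iF.
by apply/funext => x /=; rewrite sumEFin.
Qed.

Lemma Rintegral_sum I (r : seq I) (F : I -> T -> R) :
  (forall i, P.-integrable setT (EFin \o F i)) ->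
  \int[P]_x (\sum_(i <- r) F i x) = \sum_(i <- r) \int[P]_x F i x.
Proof.
move=> iF; elim: r => [|i r IH].
  under eq_Rintegral do rewrite big_nil.
  by rewrite Rintegral_cst// mul0r big_nil.
under eq_Rintegral do rewrite big_cons.
rewrite RintegralD//; first by rewrite IH big_cons.
exact: integrable_Rsum.
Qed.

(** Markov's inequality, in the real-valued form. *)
Lemma mul_fine_le_Rintegral (S : set T) (f : T -> R) (c : R) :
  measurable S -> P.-integrable setT (EFin \o f) -> (forall x, 0 <= f x) ->
  (forall x, S x -> c <= f x) -> c * fine (P S) <= \int[P]_x f x.
Proof.
move=> mS intf f0 cf; rewrite -Rintegral_cst// Rintegral_mkcond.
apply: le_Rintegral => //.
- rewrite -restrict_EFin; apply/integrable_restrict => //.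
  rewrite setTI; apply: (integrableS measurableT) => //.
  exact: (@integrable_bounded_rv (cst _) `|c|).
- move=> x _; rewrite patchE; case: ifPn => [/set_mem|_]; [exact: cf|exact: f0].
Qed.

End FiniteSumIntegral.

Section CharacteristicFunction.
Context d (T : measurableType d) (R : realType) (P : probability T R).
Context (X : T -> R) (mX : measurable_fun setT X).

(** Ecos and Esin are the real and imaginary parts of the characteristic
    function of X, and sqr_char is its squared modulus. *)
Definition Ecos (t : R) : R := \int[P]_x cos (t * X x).
Definition Esin (t : R) : R := \int[P]_x sin (t * X x).
Definition sqr_char (t : R) : R := Ecos t ^+ 2 + Esin t ^+ 2.

Lemma integrable_cos (t : R) :
  P.-integrable setT (EFin \o (fun x => cos (t * X x))).
Proof.
apply: (@integrable_bounded_rv _ _ _ _ _ 1) => [|x]; last exact: cos_max.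
apply: (@measurableT_comp _ _ _ _ _ _ (@cos R)).
  by apply: continuous_measurable_fun; exact: continuous_cos.
exact: measurable_funM.
Qed.

Lemma integrable_sin (t : R) :
  P.-integrable setT (EFin \o (fun x => sin (t * X x))).
Proof.
apply: (@integrable_bounded_rv _ _ _ _ _ 1) => [|x]; last exact: sin_max.
apply: (@measurableT_comp _ _ _ _ _ _ (@sin R)).
  by apply: continuous_measurable_fun; exact: continuous_sin.
exact: measurable_funM.
Qed.

Lemma integrableZ_R (a : R) (f : T -> R) : P.-integrable setT (EFin \o f) ->
  P.-integrable setT (EFin \o (fun x => a * f x)).
Proof. by move=> /(integrableZl measurableT a). Qed.

Lemma sqr_charN t : sqr_char (- t) = sqr_char t.
Proof.
rewrite /sqr_char; congr (_ + _).
  by rewrite /Ecos; under eq_Rintegral do rewrite mulNr cosN.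
rewrite /Esin; under eq_Rintegral do rewrite mulNr sinN -mulN1r.
by rewrite RintegralZl ?mulN1r ?sqrrN//; exact: integrable_sin.
Qed.

Lemma sqr_char_ge0 t : 0 <= sqr_char t.
Proof. by rewrite addr_ge0// sqr_ge0. Qed.

Definition fejer_avg n (y : R) : R := \int[P]_x fejer n (y - X x).

Lemma integral_cosB (t y : R) :
  \int[P]_x cos (t * (y - X x)) = cos (t * y) * Ecos t + sin (t * y) * Esin t.
Proof.
under eq_Rintegral do rewrite mulrBr cosB.
rewrite RintegralD//.
- by rewrite !RintegralZl//; [exact: integrable_sin|exact: integrable_cos].
- exact/integrableZ_R/integrable_cos.
- exact/integrableZ_R/integrable_sin.
Qed.

Lemma integrable_cosB (t y : R) :
  P.-integrable setT (EFin \o (fun x => cos (t * (y - X x)))).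
Proof.
apply: (@integrable_bounded_rv _ _ _ _ _ 1) => [|x]; last exact: cos_max.
apply: (@measurableT_comp _ _ _ _ _ _ (@cos R)).
  by apply: continuous_measurable_fun; exact: continuous_cos.
by apply: measurable_funM => //; exact: measurable_funB.
Qed.

Lemma integrable_fejerB n (y : R) :
  P.-integrable setT (EFin \o (fun x => fejer n (y - X x))).
Proof.
rewrite (_ : (fun x => _) = fun x =>
  \sum_(j < n) \sum_(l < n) cos ((j%:R - l%:R) * (y - X x))); last first.
  by apply/funext => x; rewrite fejerE.
apply: integrable_Rsum => j; apply: integrable_Rsum => l.
exact: integrable_cosB.
Qed.

Lemma fejer_avgE n y : fejer_avg n y = \sum_(j < n) \sum_(l < n)
  (Ecos (j%:R - l%:R) * cos ((j%:R - l%:R) * y) +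
   Esin (j%:R - l%:R) * sin ((j%:R - l%:R) * y)).
Proof.
rewrite /fejer_avg; under eq_Rintegral do rewrite fejerE.
rewrite Rintegral_sum => [|j]; last first.
  by apply: integrable_Rsum => l; exact: integrable_cosB.
apply: eq_bigr => j _.
rewrite Rintegral_sum => [|l]; last exact: integrable_cosB.
by apply: eq_bigr => l _; rewrite integral_cosB; congr (_ + _); rewrite mulrC.
Qed.

Let integrable_term (a b t : R) : P.-integrable setT
  (EFin \o (fun x => a * cos (t * X x) + b * sin (t * X x))).
Proof.
exact: (integrableD measurableT (integrableZ_R a (integrable_cos t))
  (integrableZ_R b (integrable_sin t))).
Qed.

Lemma integrable_fejer_avg n : P.-integrable setT (EFin \o (fejer_avg n \o X)).
Proof.
rewrite (_ : fejer_avg n \o X = fun x => \sum_(j < n) \sum_(l < n)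
  (Ecos (j%:R - l%:R) * cos ((j%:R - l%:R) * X x) +
   Esin (j%:R - l%:R) * sin ((j%:R - l%:R) * X x))); last first.
  by apply/funext => x; rewrite /= fejer_avgE.
by apply: integrable_Rsum => j; apply: integrable_Rsum.
Qed.

(** The trigonometric expansion of the kernel separates the two copies of X, so
    that the double average factors without Fubini's theorem. *)
Lemma integral_fejer_avg n : \int[P]_x fejer_avg n (X x) =
  \sum_(j < n) \sum_(l < n) sqr_char (j%:R - l%:R).
Proof.
under eq_Rintegral do rewrite fejer_avgE.
rewrite Rintegral_sum => [|j]; last exact: integrable_Rsum.
apply: eq_bigr => j _; rewrite Rintegral_sum//.
apply: eq_bigr => l _; rewrite RintegralD//.
- by rewrite !RintegralZl//; [exact: integrable_sin|exact: integrable_cos].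
- exact/integrableZ_R/integrable_cos.
- exact/integrableZ_R/integrable_sin.
Qed.

Lemma fejer_avg_ge0 n y : 0 <= fejer_avg n y.
Proof. by apply: Rintegral_ge0 => x _; exact: fejer_ge0. Qed.

Lemma fejer_avg_ge n (S : set T) (y : T) : measurable S -> S y ->
  (forall x, S x -> n%:R * `|X y - X x| <= 1) ->
  (n%:R * cos 1) ^+ 2 * fine (P S) <= fejer_avg n (X y).
Proof.
move=> mS Sy Sn; apply: mul_fine_le_Rintegral => //.
- exact: integrable_fejerB.
- by move=> x; exact: fejer_ge0.
- by move=> x Sx; exact/fejer_near0/Sn.
Qed.

End CharacteristicFunction.

(** * Square-summable characteristic functions *)

Section LebesgueCover.
Context {R : realType}.

(** Lebesgue measure unfolds to the outer measure of interval lengths, hence A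
    is arbitrary.  The covering intervals are normalized so that their length is
    the difference of their end points, the empty one being ]0, 0]. *)
Lemma lebesgue_cover (A : set R) (e : R) :
  (lebesgue_measure A < e%:E)%E ->
  exists2 ab : nat -> R * R,
    A `<=` \bigcup_k `](ab k).1, (ab k).2]%classic &
    (forall k, (ab k).1 <= (ab k).2) /\
    forall M, \sum_(k < M) ((ab k).2 - (ab k).1) <= e.
Proof.
move=> /ereal_inf_lt[_ [F [mF AF] <-] Fe].
have /choice[ab abF] : forall k, exists p : R * R, p.1 <= p.2 /\
    F k = `]p.1, p.2]%classic.
  move=> k; have [->|[p p12 ->]] := (ocitvP (F k)).1 (mF k).
    by exists (0, 0); rewrite /= set_itvoc0.
  by exists p; rewrite ltW.
exists ab; first by move=> x /AF[k _ Fx]; exists k => //; rewrite -(abF k).2.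
split=> [k|M]; first exact: (abF k).1.
rewrite -lee_fin (le_trans _ (ltW Fe))//.
apply: le_trans (nneseries_lim_ge M _) => [|k _ _]; last exact: wlength_ge0.
rewrite -sumEFin big_mkord lee_sum// => k _.
rewrite [in leRHS](abF k).2; rewrite le_eqVlt; apply/orP; left; apply/eqP/esym.
exact: wlength_itv_bnd (abF k).1.
Qed.

End LebesgueCover.

Section Concentration.
Context d (T : measurableType d) (R : realType) (P : probability T R).
Context (X : T -> R) (mX : measurable_fun setT X) (K : R)
  (KP : forall m, \sum_(k < m) sqr_char P X k%:R <= K).

(** If S is an event on which X varies by at most 1 / n, fejer_avg_ge puts S
    inside this event as soon as the probability of S exceeds delta. *)
Definition heavy n (delta : R) : set T :=
  [set x | (n%:R * cos 1) ^+ 2 * delta <= fejer_avg P X n (X x)].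

Let measurable_preimage_itv (i : interval R) : measurable (X @^-1` [set` i]).
Proof.
by rewrite -[X in measurable X]setTI; apply: mX => //; exact: measurable_itv.
Qed.

Lemma measurable_heavy n delta : measurable (heavy n delta).
Proof.
rewrite /heavy -[X in measurable X]setTI.
have /measurable_EFinP mf := measurable_int P (integrable_fejer_avg P mX n).
have := mf measurableT `[(n%:R * cos 1) ^+ 2 * delta, +oo[%classic.
rewrite (_ : _ @^-1` _ =
  [set x | (n%:R * cos 1) ^+ 2 * delta <= fejer_avg P X n (X x)]).
  by apply.
by apply/seteqP; split => x /=; rewrite in_itv/= andbT.
Qed.

(** The mean of fejer_avg is a Toeplitz sum of size O(n), whereas the threshold
    is of order n^2 delta. *)
Lemma heavy_le n delta : (0 < n)%N -> 0 < delta ->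
  fine (P (heavy n delta)) <= 2 * K / (n%:R * cos 1 ^+ 2 * delta).
Proof.
move=> n0 delta0; have n0' : 0 < n%:R :> R by rewrite ltr0n.
have c0 := cos1_gt0 R.
have := @mul_fine_le_Rintegral _ _ _ P (heavy n delta) (fejer_avg P X n \o X)
  ((n%:R * cos 1) ^+ 2 * delta) (measurable_heavy _ _)
  (integrable_fejer_avg P mX n) (fun x => fejer_avg_ge0 P X n (X x))
  (fun x => id).
rewrite integral_fejer_avg// => /le_trans/(_ (toeplitz_sum_le n
  (sqr_charN P mX) (sqr_char_ge0 P X) KP)) h.
rewrite ler_pdivlMr ?mulr_gt0 ?exprn_gt0//.
rewrite -(ler_pM2r n0') (le_trans _ h)// le_eqVlt; apply/orP; left; apply/eqP.
ring.
Qed.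

Lemma light_piece_le n delta (S : set T) : 0 < n%:R * cos 1 :> R ->
  0 <= delta -> measurable S ->
  (forall x y, S x -> S y -> n%:R * `|X x - X y| <= 1) ->
  fine (P (S `\` heavy n delta)) <= delta.
Proof.
move=> n0 delta0 mS diamS.
have [->|/set0P[y [Sy /negP]]] := eqVneq (S `\` heavy n delta) set0.
  by rewrite measure0.
rewrite -ltNge => ylt.
have mSh : measurable (S `\` heavy n delta).
  by apply: measurableD => //; exact: measurable_heavy.
apply: (@le_trans _ _ (fine (P S))).
  by rewrite fine_le ?fin_num_measure// le_measure ?inE.
have := fejer_avg_ge P mX mS Sy (fun x Sx => diamS y x Sy Sx).
by move=> /le_lt_trans/(_ ylt); rewrite ltr_pM2l ?exprn_gt0// => /ltW.
Qed.

Lemma fine_content_subadditive (A : set T) (F : nat -> set T) m :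
  (forall k, measurable (F k)) -> measurable A ->
  A `<=` \big[setU/set0]_(k < m) F k ->
  fine (P A) <= \sum_(k < m) fine (P (F k)).
Proof.
move=> mF mA /(content_subadditive P (fun k _ => mF k) mA).
rewrite -lee_fin fineK ?fin_num_measure// -sumEFin => /le_trans; apply.
by apply: lee_sum => k _; rewrite fineK ?fin_num_measure.
Qed.

(** The interval splits into at most n (b - a) + 1 pieces of length 1 / n; the
    pieces are closed and overlap at their end points, which does not affect
    subadditivity. *)
Lemma light_interval_le n delta (a b : R) : (0 < n)%N -> 0 <= delta -> a <= b ->
  fine (P (X @^-1` `]a, b]%classic `\` heavy n delta)) <=
  (n%:R * (b - a) + 1) * delta.
Proof.
move=> n0 delta0 ab; have n0' : 0 < n%:R :> R by rewrite ltr0n.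
pose m := (Num.truncn (n%:R * (b - a))).+1.
pose I (i : nat) := `[a + i%:R / n%:R, a + i.+1%:R / n%:R]%classic.
pose S (i : nat) := X @^-1` I i.
have mS i : measurable (S i) by exact: measurable_preimage_itv.
have msh (i : set T) : measurable i -> measurable (i `\` heavy n delta).
  by move=> mi; apply: measurableD => //; exact: measurable_heavy.
apply: (@le_trans _ _ (\sum_(i < m) fine (P (S i `\` heavy n delta)))).
  apply: (@fine_content_subadditive _ (fun i => S i `\` heavy n delta)).
  - by move=> i; exact: msh.
  - by apply: msh; exact: measurable_preimage_itv.
  move=> x [/= xab hx].
  rewrite -(bigcup_mkord _ (fun i => S i `\` heavy n delta)).
  move: xab; rewrite in_itv/= => /andP[ax xb].
  have nx0 : 0 <= n%:R * (X x - a) by rewrite mulr_ge0// subr_ge0 ltW.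
  exists (Num.truncn (n%:R * (X x - a))).
    by rewrite /= ltnS le_truncn// ler_wpM2l// lerD2r.
  split => //; rewrite /S/I/= in_itv/=.
  have /andP[t1 t2] := truncn_itv nx0.
  move: t1 t2; rewrite mulrC -ler_pdivrMr// -ltr_pdivlMr// => t1 t2.
  by apply/andP; split; lra.
apply: (@le_trans _ _ (\sum_(i < m) delta)).
  apply: ler_sum => i _; apply: light_piece_le => //.
    by rewrite mulr_gt0 ?cos1_gt0.
  move=> x y; rewrite /S/I/= !in_itv/= => /andP[x1 x2] /andP[y1 y2].
  rewrite mulrC -ler_pdivlMr// div1r ler_norml.
  have i1 : i.+1%:R / n%:R = i%:R / n%:R + n%:R^-1 :> R.
    by rewrite -natr1 mulrDl mul1r.
  by rewrite i1 in x2 y2; apply/andP; split; lra.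
rewrite sumr_const card_ord -[leLHS]mulr_natl ler_wpM2r// /m -natr1 lerD2r.
by rewrite truncn_le mulr_ge0// subr_ge0.
Qed.

(** With delta = eta / n, the heavy event costs O(1 / eta) and the intervals
    cost eta (L + M / n); finiteness of M makes the last error vanish as n
    grows. *)
Lemma finite_cover_le (ab : nat -> R * R) (L eta : R) M :
  (forall k, (ab k).1 <= (ab k).2) ->
  \sum_(k < M) ((ab k).2 - (ab k).1) <= L -> 0 < eta ->
  fine (P (\big[setU/set0]_(k < M) X @^-1` `](ab k).1, (ab k).2]%classic)) <=
  2 * K / (cos 1 ^+ 2 * eta) + L * eta.
Proof.
move=> ab12 abL eta0; have c0 := cos1_gt0 R.
pose I k := X @^-1` `](ab k).1, (ab k).2]%classic.
pose U := \big[setU/set0]_(k < M) I k; rewrite -/U.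
have mI k : measurable (I k) by exact: measurable_preimage_itv.
have mU : measurable U by apply: bigsetU_measurable => k _; exact: mI.
have Un n : (0 < n)%N ->
    fine (P U) <= 2 * K / (cos 1 ^+ 2 * eta) + L * eta + M%:R * eta / n%:R.
  move=> n0; have n0' : 0 < n%:R :> R by rewrite ltr0n.
  pose delta := eta / n%:R.
  have delta0 : 0 < delta by rewrite divr_gt0.
  (* index 0 holds the heavy event, the others the light parts *)
  pose F k := if k is k'.+1 then I k' `\` heavy n delta else heavy n delta.
  have mF k : measurable (F k).
    case: k => [|k]; first exact: measurable_heavy.
    by apply: measurableD => //; exact: measurable_heavy.
  have UF : U `<=` \big[setU/set0]_(k < M.+1) F k.
    rewrite /U -(bigcup_mkord M I) -(bigcup_mkord _ F) => x [k /= kM Ix].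
    have [hx|hx] := pselect (heavy n delta x); first by exists 0%N.
    by exists k.+1.
  rewrite (le_trans (fine_content_subadditive mF mU UF))//.
  rewrite big_ord_recl/= -addrA lerD//.
    rewrite (le_trans (heavy_le n0 delta0))// le_eqVlt.
    apply/orP; left; apply/eqP.
    by rewrite /delta; field; rewrite !gt_eqF.
  apply: (@le_trans _ _
    (\sum_(k < M) (n%:R * ((ab k).2 - (ab k).1) + 1) * delta)).
    by apply: ler_sum => k _; apply: light_interval_le => //; exact: ltW.
  rewrite -mulr_suml big_split/= -mulr_sumr sumr_const card_ord mulrDl.
  rewrite /delta lerD//; last by rewrite mulrA.
  by rewrite [leLHS](_ : _ = (\sum_(k < M) ((ab k).2 - (ab k).1)) * eta);
    [rewrite ler_wpM2r// ltW|field; rewrite gt_eqF].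
apply/ler_addgt0Pr => e e0.
pose n := (Num.truncn (M%:R * eta / e)).+1.
have n0 : (0 < n)%N by [].
rewrite (le_trans (Un n n0))// lerD2l ler_pdivrMr ?ltr0n//.
by rewrite [leRHS]mulrC -ler_pdivrMr// ltW// truncnS_gt.
Qed.

Lemma countable_cover_le (ab : nat -> R * R) (L eta : R) :
  (forall k, (ab k).1 <= (ab k).2) ->
  (forall M, \sum_(k < M) ((ab k).2 - (ab k).1) <= L) -> 0 < eta ->
  (P (\bigcup_k X @^-1` `](ab k).1, (ab k).2]%classic) <=
  (2 * K / (cos 1 ^+ 2 * eta) + L * eta)%:E)%E.
Proof.
move=> ab12 abL eta0.
pose I k := X @^-1` `](ab k).1, (ab k).2]%classic.
have mI k : measurable (I k) by exact: measurable_preimage_itv.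
rewrite -bigcup_bigsetU_bigcup.
have mJ k : measurable (\big[setU/set0]_(i < k.+1) I i).
  by apply: bigsetU_measurable.
have cvgJ : P \o (fun k => \big[setU/set0]_(i < k.+1) I i) @ \oo -->
    P (\bigcup_k \big[setU/set0]_(i < k.+1) I i).
  apply: nondecreasing_cvg_mu => //; first exact: bigcupT_measurable.
  by move=> i j ij; apply/subsetPset; apply: subset_bigsetU.
rewrite -(cvg_lim _ cvgJ)//; apply: lime_le.
  by apply/cvg_ex; eexists; exact: cvgJ.
apply: nearW => k.
have := @finite_cover_le ab L eta k.+1 ab12 (abL _) eta0.
by rewrite -lee_fin fineK// fin_num_measure//; exact: mJ.
Qed.

(** If A were null, the choice of eta and of a cover of A of total length
    1 / (4 eta) would bound the probability that X lies in A by 1/4 + 1/4. *)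
Lemma lebesgue_measure_gt0_of_sqr_char (A : set R) :
  P.-negligible (~` (X @^-1` A)) -> (0 < lebesgue_measure A)%E.
Proof.
move=> [N [mN PN AN]]; rewrite lt_neqAle; apply/andP; split; last first.
  exact: outer_measure_ge0.
apply/negP => /eqP A0.
have c0 := cos1_gt0 R.
have K0 : 0 <= K by rewrite (le_trans _ (KP 0))// big_ord0.
(* so that 2 K / (cos 1 ^+ 2 * eta) <= 1 / 4 *)
pose eta := 8 * K / cos 1 ^+ 2 + 1.
have eta0 : 0 < eta.
  have : 0 <= 8 * K / cos 1 ^+ 2 by rewrite divr_ge0 ?sqr_ge0// mulr_ge0.
  by rewrite /eta; lra.
have : (lebesgue_measure A < (4 * eta)^-1%:E)%E.
  by rewrite -A0 lte_fin invr_gt0 mulr_gt0.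
move=> /lebesgue_cover[ab Aab [ab12 abL]].
have := countable_cover_le ab12 abL eta0.
set U := \bigcup_k _ => PU.
have mU : measurable U.
  by apply: bigcupT_measurable => k; exact: measurable_preimage_itv.
have : (P setT <= P U + P N)%E.
  apply: (le_trans _ (measureU2 _ mU mN)); rewrite le_measure ?inE//.
    exact: measurableU.
  move=> x _; have [Ax|Ax] := pselect (A (X x)); last by right; exact: AN.
  by left; have [k _ Ik] := Aab _ Ax; exists k.
rewrite PN adde0 probability_setT => /le_trans/(_ PU).
rewrite lee_fin leNgt => /negP; apply.
have -> : (4 * eta)^-1 * eta = 4^-1.
  by rewrite invfM -mulrA mulVf ?mulr1// gt_eqF.
have : 2 * K / (cos 1 ^+ 2 * eta) <= 4^-1.
  have c2 : 0 < cos 1 ^+ 2 :> R by rewrite exprn_gt0.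
  have -> : cos 1 ^+ 2 * eta = 8 * K + cos 1 ^+ 2.
    by rewrite /eta; field; rewrite gt_eqF.
  by rewrite ler_pdivrMr; lra.
lra.
Qed.

End Concentration.

(** * Projections of a set carrying Fourier decay *)

Section Projection.
Context {R : realType} {d : nat}.
Implicit Types (mu : probability (d.-tuple R) R) (x y N xi : d.-tuple R).

Lemma measurable_dotp N : measurable_fun setT (fun x : d.-tuple R => dotp x N).
Proof.
apply: measurable_sum => i; apply: measurable_funM => //.
exact: measurable_tnth.
Qed.

Lemma dotp_gt0 N i : tnth N i != 0 -> 0 < dotp N N.
Proof.
move=> Ni; rewrite /dotp (bigD1 i)//= ltr_pwDl//.
  by rewrite -expr2 exprn_even_gt0.
by rewrite sumr_ge0// => j _; rewrite -expr2 sqr_ge0.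
Qed.

Definition scalep (t : R) N : d.-tuple R := [tuple t * tnth N i | i < d].

Lemma dotp_scalep t x N : dotp x (scalep t N) = t * dotp x N.
Proof.
by rewrite mulr_sumr; apply: eq_bigr => i _; rewrite tnth_mktuple mulrCA.
Qed.

Lemma enorm_scalep t N : 0 <= t -> enorm (scalep t N) = t * enorm N.
Proof.
move=> t0; rewrite /enorm.
have -> : dotp (scalep t N) (scalep t N) = t ^+ 2 * dotp N N.
  rewrite dotp_scalep expr2 -mulrA; congr (_ * _).
  by rewrite !mulr_sumr; apply: eq_bigr => i _; rewrite tnth_mktuple mulrA.
by rewrite sqrtrM ?sqr_ge0// sqrtr_sqr ger0_norm.
Qed.

Lemma normc_fourier_scalep mu N t :
  Normc.normc (fourier mu (scalep (t / (2 * pi)) N)) ^+ 2 =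
  sqr_char mu (fun x => dotp x N) t.
Proof.
have e x : - (2 * pi * dotp x (scalep (t / (2 * pi)) N)) = - t * dotp x N.
  have : (pi : R) != 0 by rewrite gt_eqF// pi_gt0.
  by rewrite dotp_scalep; move: (pi : R) => p p0; field.
transitivity (sqr_char mu (fun x => dotp x N) (- t)); last first.
  exact: sqr_charN (measurable_dotp N) _.
rewrite /fourier /Cintegral /=.
rewrite sqr_sqrtr ?addr_ge0 ?sqr_ge0// /sqr_char /Ecos /Esin.
by congr (_ ^+ 2 + _ ^+ 2); apply: eq_Rintegral => x _; rewrite e.
Qed.

(** The loss eps = (s - 1) / 4 leaves, after squaring, the exponent
    s - 2 eps = 1 + (s - 1) / 2, still larger than 1. *)
Lemma sqr_char_decay mu N (s : R) : fourier_decay mu s -> 1 < s ->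
  0 < dotp N N -> exists2 D : R, 0 <= D & exists k0 : nat,
    forall k, (k0 <= k)%N -> sqr_char mu (fun x => dotp x N) k.+1%:R <=
      D * k.+1%:R `^ (- (1 + (s - 1) / 2)).
Proof.
move=> decay s1 N0; have eps0 : 0 < (s - 1) / 4 by lra.
have [C C0 [M CM]] := decay _ eps0.
pose c := enorm N / (2 * pi).
have pi2 : 0 < 2 * pi :> R by rewrite mulr_gt0// pi_gt0.
have c0 : 0 < c by rewrite divr_gt0// sqrtr_gt0.
exists (C ^+ 2 * c `^ (- (1 + (s - 1) / 2))).
  by rewrite mulr_ge0 ?sqr_ge0 ?powR_ge0.
exists (Num.truncn (M / c)) => k k0.
set n : R := k.+1%:R.
have n0 : 0 < n by rewrite ltr0n.
have normE : enorm (scalep (n / (2 * pi)) N) = n * c.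
  by rewrite enorm_scalep ?divr_ge0 ?ltW// /c mulrAC mulrA.
have /CM : M <= enorm (scalep (n / (2 * pi)) N).
  rewrite normE -ler_pdivrMr// ltW// (lt_le_trans (truncnS_gt _))//.
  by rewrite ler_nat ltnS.
rewrite -normc_fourier_scalep normE => h.
have nc0 : n * c != 0 by rewrite gt_eqF// mulr_gt0.
have -> : C ^+ 2 * c `^ (- (1 + (s - 1) / 2)) * n `^ (- (1 + (s - 1) / 2)) =
    (C * (n * c) `^ ((s - 1) / 4) * (n * c) `^ (- (s / 2))) ^+ 2.
  rewrite -mulrA -[in RHS]mulrA -powRD ?nc0 ?implybT//.
  rewrite exprMn; congr (_ * _).
  rewrite -powR_mulrn ?powR_ge0// -powRrM mulrC -powRM ?ltW//.
  by congr (_ `^ _); field.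
rewrite lerXn2r// nnegrE ?mulr_ge0 ?powR_ge0 ?(ltW C0)// /Normc.normc.
by case: fourier => *; exact: sqrtr_ge0.
Qed.

Lemma projection_gt0 mu (E : set (d.-tuple R)) (s : R) N :
  mu.-negligible (~` E) -> fourier_decay mu s -> 1 < s -> 0 < dotp N N ->
  (0 < lebesgue_measure [set dotp x N | x in E])%E.
Proof.
move=> muE decay s1 N0.
have [D D0 [k0 qD]] := sqr_char_decay decay s1 N0.
have a0 : 0 < (s - 1) / 2 by lra.
apply: (lebesgue_measure_gt0_of_sqr_char (measurable_dotp N)
  (sum_le_of_powR_decay a0 D0 (fun k => sqr_char_ge0 mu _ k%:R) qD)).
by apply: negligibleS muE => x /= nx Ex; apply: nx; exists x.
Qed.

End Projection.

(** * From projections to determinants *)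

Section Determinant.
Context {R : realType} {d : nat}.
Context (E : set (d.-tuple R)) (projE : forall N : d.-tuple R, 0 < dotp N N ->
  (0 < lebesgue_measure [set dotp x N | x in E])%E).

Definition tuple_of_row (v : 'rV[R]_d) : d.-tuple R := [tuple v 0 i | i < d].

Definition row_of_tuple (x : d.-tuple R) : 'rV[R]_d := \row_i tnth x i.

Lemma row_of_tupleK : cancel row_of_tuple tuple_of_row.
Proof. by move=> x; apply: eq_from_tnth => i; rewrite tnth_mktuple mxE. Qed.

Lemma exists_dotp_neq0 N : 0 < dotp N N -> exists2 y, E y & dotp y N != 0.
Proof.
move=> /projE; apply: contraPP => h; apply/negP; rewrite -leNgt.
rewrite -(lebesgue_measure_set1 (0 : R)) le_outer_measure// => _ [y Ey <-].
by apply/eqP; apply: contra_notT h => yN; exists y.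
Qed.

(** The points of E are the rows of A.  As long as there are fewer than d of
    them, some nonzero v is orthogonal to all; a point y of E with y . v
    nonzero is independent from the previous ones. *)
Lemma exists_row_free r : (r <= d)%N -> exists2 A : 'M[R]_(r, d),
  row_free A & forall j, E (tuple_of_row (row j A)).
Proof.
elim: r => [_|r IH rd].
  by exists 0; [apply/eqP; rewrite mxrank0|case].
have [A Afree AE] := IH (ltnW rd).
have : kermx A^T != 0.
  by rewrite -mxrank_eq0 mxrank_ker mxrank_tr (eqP Afree) -lt0n subn_gt0.
move=> /rowV0Pn[v /sub_kermxP vA v0].
have vdot (w : 'rV[R]_d) :
    w *m v^T = (dotp (tuple_of_row w) (tuple_of_row v))%:M.
  apply/matrixP => i j; rewrite !ord1 !mxE eqxx mulr1n; apply: eq_bigr => k _.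
  by rewrite !tnth_mktuple mxE.
have [i vi] : exists i, v 0 i != 0.
  by move/rV0Pn: v0.
have /exists_dotp_neq0[y Ey yv] : 0 < dotp (tuple_of_row v) (tuple_of_row v).
  by apply: (@dotp_gt0 _ _ _ i); rewrite tnth_mktuple.
exists (col_mx (row_of_tuple y) A); last first.
  move=> j; case: (@split_ordP 1 r j) => k ->.
    by rewrite (@rowKu _ 1 r) ord1 row_id row_of_tupleK.
  by rewrite (@rowKd _ 1 r).
apply: inj_row_free => u.
rewrite -[u](@hsubmxK _ 1 1 r) (@mul_row_col _ 1 1 r) => uA.
set u1 := lsubmx _ in uA *; set u2 := rsubmx _ in uA *.
have : (u1 *m row_of_tuple y + u2 *m A) *m v^T = 0.
  by rewrite uA mul0mx.
have Av : A *m v^T = 0 by apply: trmx_inj; rewrite trmx_mul trmxK vA trmx0.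
rewrite mulmxDl -!mulmxA Av mulmx0 addr0 vdot row_of_tupleK mul_mx_scalar.
move=> /eqP; rewrite scaler_eq0 (negbTE yv)/= => /eqP lu.
move: uA; rewrite lu mul0mx add0r -[RHS](mul0mx _ A).
by move=> /(row_free_inj Afree) ->; rewrite row_mx0.
Qed.

(** Freeze all the rows but one of an invertible matrix with rows in E: the
    determinant becomes a linear form in the remaining row, whose coefficients
    are cofactors independent of it. *)
Lemma projection_sub_volume_set : (0 < d)%N -> exists2 N : d.-tuple R,
  0 < dotp N N & [set dotp x N | x in E] `<=` volume_set E.
Proof.
move=> d0; have [A Afree AE] := exists_row_free (leqnn d).
pose j0 := Ordinal d0.
have detA : \det A != 0 by move: Afree; rewrite row_free_unit unitmxE unitfE.
exists [tuple cofactor A j0 i | i < d].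
  have [i Ni] : exists i, cofactor A j0 i != 0.
    apply/existsP; apply: contraNT detA; rewrite negb_exists => /forallP cof0.
    rewrite (expand_det_row A j0) big1// => i _.
    by have := cof0 i; rewrite negbK => /eqP ->; rewrite mulr0.
  by apply: (@dotp_gt0 _ _ _ i); rewrite tnth_mktuple.
move=> _ [y Ey <-].
pose x j := if j == j0 then y else tuple_of_row (row j A).
exists x; first by move=> j; rewrite /x; case: ifP.
rewrite -det_tr (expand_det_row _ j0); apply: eq_bigr => i _.
rewrite tnth_mktuple !mxE /x eqxx; congr (_ * _).
rewrite /cofactor; congr (_ * \det _); apply/matrixP => a b.
by rewrite !mxE eq_sym (negbTE (neq_lift _ _)) tnth_mktuple mxE.
Qed.

End Determinant.

(* lebesgue_measure is total: on a non-measurable set it is the Lebesgue outer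
   measure. *)
Theorem theorem1p6 (R : realType) (d : nat) (E : set (d.-tuple R)) :
  (2 <= d)%N ->
  salem E ->
  ((d%:R - 1 : R)%R%:E < hausdorff_dim E)%E ->
  (0 < lebesgue_measure (volume_set E))%E.
Proof.
move=> d2 [s -> [mu muE decay]]; rewrite lte_fin => ds.
have s1 : 1 < s.
  have : 2 <= d%:R :> R by rewrite ler_nat.
  lra.
have projE N : 0 < dotp N N ->
    (0 < lebesgue_measure [set dotp x N | x in E])%E.
  by move=> N0; exact: projection_gt0 muE decay s1 N0.
have [N N0 NE] := projection_sub_volume_set projE (ltnW d2).
by apply: lt_le_trans (projE N N0) _; exact: le_outer_measure.
Qed.
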